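(* Let $G$ be a discrete uncountable group, let $w:G\to(0,\infty)$ be a weight and let $1\leqslant p<\infty$. If $\mathcal{L}_p^w(G)$ is an algebra with respect to convolution, then $p\leqslant 2$.
   Context: For a discrete group $G$ (with counting measure), a weight $w:G\to(0,\infty)$ and $1\leqslant p<\infty$, $$\mathcal{L}_p^w(G)=\Big\{f:G\to\mathbb{C}\ :\ \sum_{x\in G}|f(x)w(x)|^p<\infty\Big\}.$$ Convolution is $(f*g)(s)=\sum_{t\in G}f(t)g(t^{-1}s)$. That $\mathcal{L}_p^w(G)$ is an algebra means that for all $f,g\in\mathcal{L}_p^w(G)$ the convolution $f*g$ is defined (the sums converge absolutely) and belongs to $\mathcal{L}_p^w(G)$. *)

(* Defs.v *)
From mathcomp Require Import all_boot all_order all_algebra.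
From mathcomp Require Import all_classical all_reals all_analysis.
From mathcomp Require Import summability.
From mathcomp Require Import complex.

Set Implicit Arguments.
Unset Strict Implicit.
Unset Printing Implicit Defensive.

Import Order.TTheory GRing.Theory Num.Theory.
Import numFieldNormedType.Exports.

Local Open Scope classical_set_scope.
Local Open Scope complex_scope.
Local Open Scope ring_scope.

Definition weighted_lp (R : realType) (G : groupType) (p : R) (w : G -> R) :
    set (G -> R[i]) :=
  [set f | (\esum_(x in [set: G])
              ((Normc.normc (f x * (w x)%:C) `^ p)%:E) < +oo)%E].

Definition convolution_defined (R : realType) (G : groupType)
    (f g : G -> R[i]) : Prop :=
  forall s : G,
    (\esum_(t in [set: G]) (Normc.normc (f t * g (t^-1 * s)%g))%:E < +oo)%E.

(* The unordered sum over G: the limit of the finite partial sums along the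
   directed set of finite subsets of G; R[i]^o is R[i] as a normed space over
   itself. *)
Definition convolution (R : realType) (G : groupType) (f g : G -> R[i]) :
    G -> R[i] :=
  fun s => summability.sum (fun t => f t * g (t^-1 * s)%g : R[i]^o).

Definition is_convolution_algebra (R : realType) (G : groupType)
    (A : set (G -> R[i])) : Prop :=
  forall f g : G -> R[i], A f -> A g ->
    convolution_defined f g /\ A (convolution f g).

(* Main.v *)
Require Import Defs.
From mathcomp Require Import all_boot all_order all_algebra.
From mathcomp Require Import all_classical all_reals all_analysis.
From mathcomp Require Import complex.
From mathcomp Require Import lra.

Import Order.TTheory GRing.Theory Num.Theory.
Import numFieldNormedType.Exports.

Local Open Scope classical_set_scope.
Local Open Scope ring_scope.

(** Suppose that $p > 2$.  Since $G$ is the union of the sets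
    $\{x : w(x) \le N, w(x^{-1}) \le N\}$ for $N = 0, 1, 2, \dots$, one of
    them is infinite ([infinite_sublevel]), so it contains a sequence of
    distinct points $e_0, e_1, \dots$  The weight is bounded by $N$ on the
    sequence and on the inverses, so any function carried by either of them
    whose values there are $(n+1)^{-1/2}$ is in $\mathcal{L}_p^w(G)$
    ([weighted_lp_supported_on_seq]): its $p$-th powers are dominated by
    $N^p (n+1)^{-p/2}$, which is summable because $p/2 > 1$
    ([cvg_riemannR]).  Let $f$ be such a function carried by the $e_n$ and put
    $g(x) = f(x^{-1})$.  At the unit of $G$ the convolution of $f$ and $g$ is
    $\sum_n f(e_n) g(e_n^{-1}) = \sum_n 1/(n+1)$, a divergent series of
    nonnegative terms, so the convolution is not defined there. *)

Lemma esum_nat_ltyP (R : realType) (u : nat -> R) (u_ge0 : forall n, 0 <= u n) :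
  (\esum_(n in [set: nat]) (u n)%:E < +oo)%E <-> cvgn (series u).
Proof.
rewrite -nneseries_esumT; last by move=> n; rewrite lee_fin.
split => [u_lty | u_cvg].
  apply: nondecreasing_is_cvgn; first exact: nondecreasing_series.
  exists (fine (\sum_(n <oo) (u n)%:E)%E) => _ [n _ <-].
  rewrite -lee_fin fineK; last first.
    by rewrite ge0_fin_numE// nneseries_ge0// => k _ _; rewrite lee_fin.
  rewrite /series /= -sumEFin.
  by apply: nneseries_lim_ge => k _ _; rewrite lee_fin.
rewrite (_ : (fun n => _) = EFin \o series u).
  by rewrite EFin_lim// ltry.
by apply/funext => n /=; rewrite /series /= sumEFin.
Qed.

(** This is the mean value estimate for $x \mapsto -x^{-r}$ on $[y, x]$ with
    $x = y + 1$.  It follows from $1 + t \le e^t$ applied twice: for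
    $(x/y)^r = e^{r \ln(x/y)}$, and for $\ln(y/x) \le y/x - 1 = -1/x$. *)
Lemma powRN_telescope (R : realType) (r y : R) (r_gt0 : 0 < r) (y_gt0 : 0 < y) :
  r * (y + 1) `^ (- (r + 1)) + (y + 1) `^ (- r) <= y `^ (- r).
Proof.
have x_gt0 : 0 < y + 1 by rewrite addr_gt0.
set x := y + 1 in x_gt0 *.
have ln_le : ln y - ln x <= - x^-1.
  rewrite -ln_div ?posrE//.
  have -> : y / x = 1 + - x^-1.
    by rewrite (_ : y = x - 1) ?mulrBl ?divff ?gt_eqF ?mul1r// /x addrK.
  by rewrite le_ln1Dx// ltrN2 invf_lt1// ltrDr.
have -> : x `^ (- (r + 1)) = x `^ (- r) * x^-1.
  rewrite opprD powRD; last by rewrite (gt_eqF x_gt0) implybT.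
  by rewrite powR_inv1// ltW.
have -> : y `^ (- r) = x `^ (- r) * expR (- r * (ln y - ln x)).
  by rewrite /powR !gt_eqF// -expRD; congr expR; lra.
rewrite mulrCA -[X in _ + X]mulr1 -mulrDr ler_wpM2l ?powR_ge0//.
apply: le_trans (expR_ge1Dx _).
by rewrite addrC lerD2l mulNr -mulrN ler_wpM2l ?(ltW r_gt0)// lerNr.
Qed.

(** Telescoping replaces the integral test: the partial sums stay below
    $q/(q-1)$, the first term plus $\int_1^\infty x^{-q}\,dx = 1/(q-1)$. *)
Lemma cvg_riemannR (R : realType) (q : R) (q_gt1 : 1 < q) :
  cvgn (series (riemannR q)).
Proof.
have q_gt0 : 0 < q by rewrite (lt_trans ltr01).
have r_gt0 : 0 < q - 1 by rewrite subr_gt0.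
apply: nondecreasing_is_cvgn.
  by apply: nondecreasing_series => n _; rewrite ltW ?riemannR_gt0 ?ltW.
(* The remainder (n+1)^-(q-1) makes the left side nonincreasing in n: by
   powRN_telescope its decrease pays for the next summand. *)
have bound n : (q - 1) * series (riemannR q) n.+1 + n.+1%:R `^ (- (q - 1))
               <= q.
  elim: n => [|n IHn].
    rewrite /series /= big_nat1 /riemannR !powR1 invr1 mulr1; lra.
  rewrite seriesSr mulrDr -addrA -[leRHS]addr0.
  have := powRN_telescope _ _ _ r_gt0 (ltr0Sn R n).
  rewrite subrK natr1 /riemannR -powRN => tel.
  by rewrite addr0; apply: le_trans IHn; rewrite lerD2l.
exists (q / (q - 1)) => _ [n _ <-].
have le_S : series (riemannR q) n <= series (riemannR q) n.+1.
  by rewrite seriesSr lerDl ltW ?riemannR_gt0 ?ltW.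
apply: le_trans le_S _; rewrite ler_pdivlMr// mulrC.
by apply: le_trans (bound n); rewrite lerDl powR_ge0.
Qed.

Lemma esum_supported_on_seq (R : realType) (T : choiceType) (e : nat -> T)
    (F : T -> \bar R) (e_inj : injective e)
    (F_out : forall x, ~ range e x -> F x = 0%E) :
  (\esum_(x in [set: T]) F x = \esum_(n in [set: nat]) F (e n))%E.
Proof.
rewrite -(esum_image _ e F); last by move=> m n _ _ /e_inj.
rewrite [RHS]esum_mkcond; apply: eq_esum => x _.
by case: ifPn => // /negP; rewrite inE => /F_out.
Qed.

Lemma extend_seq (T V : Type) (e : nat -> T) (b : nat -> V) (v : V)
    (e_inj : injective e) :
  exists f : T -> V, (forall n, f (e n) = b n) /\
                     (forall x, ~ range e x -> f x = v).
Proof.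
have [f f_spec] : {f : T -> V & forall x,
    (forall n, e n = x -> f x = b n) /\ (~ range e x -> f x = v)}.
  apply: (@choice T V (fun x y => (forall n, e n = x -> y = b n) /\
                                  (~ range e x -> y = v))) => x.
  have [[n _ <-]|nex] := pselect (range e x).
    by exists (b n); split => [m /e_inj ->//|]; case; exists n.
  by exists v; split => // n en; case: nex; exists n.
by exists f; split => [n|x]; [exact: (f_spec (e n)).1 | exact: (f_spec x).2].
Qed.

(** If all these sets were finite, then their countable union, which is the
    whole type by the archimedean property, would be countable. *)
Lemma infinite_sublevel (R : realType) (T : Type) (h : T -> R)
    (T_uncountable : ~ countable [set: T]) :
  exists N : nat, infinite_set [set x | h x <= N%:R].
Proof.
apply: contrapT => /forallNP fin; apply: T_uncountable.
rewrite (_ : [set: T] = \bigcup_(N in [set: nat]) [set x | h x <= N%:R]).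
  apply: bigcup_countable => // N _.
  by apply: finite_set_countable; apply: contrapT; exact: fin.
apply/seteqP; split => // x _.
by exists (Num.truncn (h x)).+1 => //=; rewrite ltW ?truncnS_gt.
Qed.

Lemma infinite_set_seq (T : Type) (A : set T) (A_inf : infinite_set A) :
  exists2 e : nat -> T, injective e & forall n, A (e n).
Proof.
move: A_inf => /infiniteP /card_leP /injfunPex [f _ f_inj].
pose i n : [set: nat] := SigSub (mem_set (I : [set: nat] n)).
exists (fun n => set_val (f (i n))) => [m n /val_inj | n].
  by move=> /f_inj; rewrite !inE => /(_ I I) [].
exact: set_valP.
Qed.

Lemma normc_real (R : realType) (a : R) : Normc.normc (a%:C)%C = `|a|.
Proof. by rewrite /= expr0n addr0 sqrtr_sqr. Qed.

(** The $p$-th power sum is dominated by $N^p \sum_n (n+1)^{-qp}$, and this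
    series converges because $qp > 1$. *)
Lemma weighted_lp_supported_on_seq (R : realType) (G : groupType) (p q N : R)
    (w : G -> R) (w_gt0 : forall x, 0 < w x) (e : nat -> G)
    (e_inj : injective e) (we_le : forall n, w (e n) <= N) (f : G -> R[i])
    (f_e : forall n, f (e n) = ((riemannR q n)%:C)%C)
    (f_out : forall x, ~ range e x -> f x = 0)
    (p_gt0 : 0 < p) (q_ge0 : 0 <= q) (qp_gt1 : 1 < q * p) :
  weighted_lp p w f.
Proof.
rewrite /weighted_lp /= (esum_supported_on_seq _ _ e)//; last first.
  by move=> x /f_out ->; rewrite mul0r Normc.normc0 powR0 ?gt_eqF.
apply/(esum_nat_ltyP _ (fun n =>
  Normc.normc (f (e n) * (w (e n))%:C)%C `^ p)).
  by move=> n; exact: powR_ge0.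
apply: (@series_le_cvg _ _ (fun n => N `^ p * riemannR (q * p) n)).
- by move=> n; exact: powR_ge0.
- move=> n; rewrite mulr_ge0 ?powR_ge0// ltW// riemannR_gt0//.
  by rewrite ltW// (lt_trans ltr01).
- move=> n; rewrite f_e Normc.normcM !normc_real.
  rewrite !ger0_norm ?(ltW (w_gt0 _)) ?(ltW (riemannR_gt0 _ _))//.
  have r_ge0 : 0 <= riemannR q n by rewrite ltW ?riemannR_gt0.
  rewrite powRM// ?(ltW (w_gt0 _))// mulrC /riemannR -!powRN -powRrM mulNr.
  have N_ge0 : 0 <= N by exact: le_trans (ltW (w_gt0 (e n))) (we_le n).
  by rewrite ler_wpM2r ?powR_ge0// ge0_ler_powR ?nnegrE
    ?(ltW p_gt0) ?(ltW (w_gt0 _)).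
- by apply: is_cvg_seriesZ; exact: cvg_riemannR.
Qed.

Theorem proposition1p2 (R : realType) (G : groupType)
  (G_uncountable : ~ countable [set: G])
  (w : G -> R) (w_gt0 : forall x : G, 0 < w x)
  (p : R) (p_ge1 : 1 <= p)
  (Lpw_algebra : is_convolution_algebra (weighted_lp p w)) :
  p <= 2.
Proof.
rewrite leNgt; apply/negP => p_gt2.
have [N] := infinite_sublevel _ _ (fun x => Num.max (w x) (w x^-1%g))
  G_uncountable.
move=> /infinite_set_seq [e e_inj e_le].
have we_le n : w (e n) <= N%:R.
  by have := e_le n; rewrite /= ge_max => /andP[].
have weV_le n : w (e n)^-1%g <= N%:R.
  by have := e_le n; rewrite /= ge_max => /andP[].
have [f [f_e f_out]] :=
  extend_seq _ _ e (fun n => ((riemannR (2^-1 : R) n)%:C)%C) 0 e_inj.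
pose g x := f x^-1%g.
have p_gt0 : 0 < p by rewrite (lt_le_trans ltr01).
have hp_gt1 : 1 < 2^-1 * p by lra.
have f_lp : weighted_lp p w f.
  exact: (weighted_lp_supported_on_seq _ _ _ (2^-1) N%:R _ _ e).
have g_lp : weighted_lp p w g.
  apply: (weighted_lp_supported_on_seq _ _ _ (2^-1) N%:R _ _
    (fun n => (e n)^-1%g)) => //.
  - by move=> m n /invg_inj /e_inj.
  - by move=> n; rewrite /g invgK.
  - move=> x x_out; apply: f_out => -[n _ en]; apply: x_out.
    by exists n => //; rewrite en invgK.
have [fg_def _] := Lpw_algebra _ _ f_lp g_lp.
(* The factor f t alone confines the sum over t to the points of e. *)
have := fg_def 1%g; rewrite (esum_supported_on_seq _ _ e)//; last first.
  by move=> x /f_out ->; rewrite mul0r Normc.normc0.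
move=> /(esum_nat_ltyP _ (fun n =>
  Normc.normc (f (e n) * g ((e n)^-1 * 1)%g))) fg_cvg.
apply: (@dvg_harmonic R).
have -> : harmonic = (fun n => Normc.normc (f (e n) * g ((e n)^-1 * 1)%g)).
  apply/funext => n; rewrite mulg1 /g invgK f_e Normc.normcM normc_real.
  (* ((n+1)^(-1/2))^2 = 1/(n+1) *)
  rewrite ger0_norm ?ltW ?riemannR_gt0//.
  rewrite /riemannR -invfM -powRD ?pnatr_eq0 ?implybT//.
  by rewrite (_ : 2^-1 + 2^-1 = 1 :> R) ?powRr1//; lra.
apply: fg_cvg => n.
by rewrite mulg1 /g invgK f_e Normc.normcM normc_real mulr_ge0.
Qed.
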